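(* Let $\mathbb{T}$ be a time scale, $t_0\in\mathbb{T}$, and let $$H[y]_{\mathbb{T}}(t)+\int_{t_0}^{t}G[y]_{\mathbb{T}}(s)\,\Delta s=\mathrm{const}$$ be a given integro-differential equation. If $$\partial_2H[y]_{\mathbb{T}}(t)+\partial_3G[y]_{\mathbb{T}}(t)=0,$$ then its equation of variation $$\partial_2H[u]_{\mathbb{T}}(t)\,u^{\sigma}(t)+\partial_3H[u]_{\mathbb{T}}(t)\,u^{\Delta}(t)+\int_{t_0}^{t}\Big(\partial_2G[u]_{\mathbb{T}}(s)\,u^{\sigma}(s)+\partial_3G[u]_{\mathbb{T}}(s)\,u^{\Delta}(s)\Big)\Delta s=0$$ is self-adjoint.
   Context: A time scale $\mathbb{T}$ is a nonempty closed subset of $\mathbb{R}$. The forward jump operator is $\sigma(t)=\inf\{s\in\mathbb{T}:s>t\}$ for $t\ne\sup\mathbb{T}$, with $\sigma(\sup\mathbb{T})=\sup\mathbb{T}$ if $\sup\mathbb{T}<\infty$; the backward jump operator is $\rho(t)=\sup\{s\in\mathbb{T}:s<t\}$ for $t\neq\inf\mathbb{T}$, with $\rho(\inf\mathbb{T})=\inf\mathbb{T}$ if $\inf\mathbb{T}>-\infty$. Write $f^\sigma(t)=f(\sigma(t))$. The set $\mathbb{T}^\kappa$ is $\mathbb{T}\setminus\{\sup\mathbb{T}\}$ if $\rho(\sup\mathbb{T})<\sup\mathbb{T}<\infty$ and $\mathbb{T}$ otherwise. The delta derivative $f^\Delta(t)$ at $t\in\mathbb{T}^\kappa$ is the number (if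 it exists) such that for every $\varepsilon>0$ there is a neighborhood $U$ of $t$ with $|f^\sigma(t)-f(s)-f^\Delta(t)(\sigma(t)-s)|\le\varepsilon|\sigma(t)-s|$ for all $s\in U$. A function $f:\mathbb{T}\to\mathbb{R}$ is rd-continuous ($f\in C_{rd}$) if it is continuous at right-dense points ($\sigma(t)=t$) and has finite left-sided limits at left-dense points ($\rho(t)=t$). For rd-continuous $f$, $\int_a^b f(t)\,\Delta t=F(b)-F(a)$ where $F^\Delta=f$ on $\mathbb{T}^\kappa$. Notation: $\partial_i$ denotes the partial derivative with respect to the $i$-th argument, and $[y]_{\mathbb{T}}(t)=(t,y^\sigma(t),y^\Delta(t))$, so that $F[y]_{\mathbb{T}}(t)=F(t,y^\sigma(t),y^\Delta(t))$. ''const'' means some real constant independent of $t$. Functions $y$ belong to $\mathbb{D}$, the set of $y:\mathbb{T}\to\mathbb{R}$ such that $y^\Delta:\mathbb{T}^\kappa\to\mathbb{R}$ is continuous. Standing assumptions on the integro-differential equation (part of the definition of its equation of variation): $\partial_3H\ne0$, and for $F\in\{G,H\}$ the functions $t\mapsto\partial_2F[y]_{\mathbb{T}}(t)$ and $t\mapsto\partial_3F[y]_{\mathbb{T}}(t)$ are in $C_{rd}$ along every curve $y$. Self-adjointness: a first order integro-differential dynamic equation in $u$ is self-adjoint if it has the form $Lu(t)=\mathrm{const}$, where $Lu(t)=p(t)u^\Delta(t)+\int_{t_0}^t q(s)u^\sigma(s)\,\Delta s$, with $p,q\in C_{rd}$, $p(t)\neq0$ for all $t\in\mathbb{T}$,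 and $t_0\in\mathbb{T}$. In the equation of variation, the coefficients $\partial_iH[u]_{\mathbb{T}}$, $\partial_iG[u]_{\mathbb{T}}$ are regarded as functions of $t$ along the curve $u$.
   Formalization: Two hypotheses are added along the curve u, without which the claim fails: ∂₃G[u] is delta differentiable on T^κ with rd-continuous delta derivative, and ∂₃H[u](t) + (σ(t) − t)·∂₂H[u](t) ≠ 0 for all t in T^κ. *)

(* Defs.v *)
From HB Require Import structures.
From mathcomp Require Import all_boot all_order all_algebra.
From mathcomp Require Import all_classical all_reals all_analysis.

Set Implicit Arguments.
Unset Strict Implicit.
Unset Printing Implicit Defensive.

Import Order.TTheory GRing.Theory Num.Theory.
Import numFieldNormedType.Exports.
Local Open Scope classical_set_scope.
Local Open Scope ring_scope.

(* A function on a time scale T is represented by a total function R -> R of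
   which only the values on T are meaningful. *)
Section TimeScales.
Context {R : realType}.
Implicit Types (T : set R) (f p q u v y : R -> R) (F G H : R -> R -> R -> R).

Definition time_scale T : Prop := T !=set0 /\ closed T.

(* For t in T, the set below is empty exactly when t = sup T. *)
Definition sigma T (t : R) : R :=
  if pselect ([set s | T s /\ t < s] !=set0)
  then inf [set s | T s /\ t < s] else t.

Definition rho T (t : R) : R :=
  if pselect ([set s | T s /\ s < t] !=set0)
  then sup [set s | T s /\ s < t] else t.

Definition mu T (t : R) : R := sigma T t - t.

Definition tkappa T : set R :=
  if pselect (has_ubound T /\ rho T (sup T) < sup T)
  then T `\ sup T else T.

Definition is_delta_deriv T f (t d : R) : Prop :=
  forall e : R, 0 < e -> \forall s \near within T (nbhs t),
    `|f (sigma T t) - f s - d * (sigma T t - s)| <= e * `|sigma T t - s|.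

Definition delta_derivable T f (t : R) : Prop :=
  exists d, is_delta_deriv T f t d.

(* Meaningful at points of T^kappa where f is delta differentiable. *)
Definition delta_deriv T f (t : R) : R := get (is_delta_deriv T f t).

(* A left-scattered maximum of T is an isolated point of T, so neither clause
   depends on the value of f there; hence rd_continuous T f also makes sense
   when f is meaningful only on T^kappa, e.g. when f involves a delta
   derivative. *)
Definition rd_continuous T f : Prop :=
  (forall t, T t -> sigma T t = t -> f s @[s --> within T (nbhs t)] --> f t)
  /\
  (forall t, T t -> rho T t = t ->
     exists l : R, f s @[s --> within (T `&` [set s | s < t]) (nbhs t)] --> l).

Definition rd_C1 T f : Prop :=
  (forall t, tkappa T t -> delta_derivable T f t) /\
  rd_continuous T (delta_deriv T f).

Definition delta_antideriv T f (P : R -> R) : Prop :=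
  forall t, tkappa T t -> is_delta_deriv T P t (f t).

(* The value P b - P a does not depend on the antiderivative P. *)
Definition delta_int T f (a b : R) : R :=
  get [set I | exists2 P, delta_antideriv T f P & I = P b - P a].

(* The class D of the admissible curves. *)
Definition curve T y : Prop :=
  (forall t, tkappa T t -> delta_derivable T y t) /\
  {within tkappa T, continuous (delta_deriv T y)}.

(* F[y](t) = F (t, y^sigma (t), y^Delta (t)) *)
Definition along T F y (t : R) : R := F t (y (sigma T t)) (delta_deriv T y t).

Definition partial2 F (t x z : R) : R := derive1 (fun x' => F t x' z) x.
Definition partial3 F (t x z : R) : R := derive1 (fun z' => F t x z') z.

Definition has_rd_partials T F : Prop :=
  (forall t x z, tkappa T t ->
     derivable (fun x' => F t x' z) x 1 /\ derivable (fun z' => F t x z') z 1)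
  /\
  (forall y, curve T y ->
     rd_continuous T (along T (partial2 F) y) /\
     rd_continuous T (along T (partial3 F) y)).

(* Standing assumptions on H[y](t) + \int_(t0)^t G[y](s) Delta s = const. *)
Definition integro_diff_assumptions T H G : Prop :=
  [/\ has_rd_partials T H, has_rd_partials T G &
      forall t x z, tkappa T t -> partial3 H t x z != 0].

(* Left-hand side, at the unknown v, of the equation of variation whose
   coefficients are the functions of t obtained along the curve u; the
   equation of variation itself is variation_lhs T t0 H G u u t = 0. *)
Definition variation_lhs T t0 H G u v (t : R) : R :=
  along T (partial2 H) u t * v (sigma T t) +
  along T (partial3 H) u t * delta_deriv T v t +
  delta_int T (fun s => along T (partial2 G) u s * v (sigma T s) +
                        along T (partial3 G) u s * delta_deriv T v s) t0 t.

Definition self_adjoint_op T t0 p q v (t : R) : R :=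
  p t * delta_deriv T v t +
  delta_int T (fun s => q s * v (sigma T s)) t0 t.

(* The equation Phi v t = 0 in the unknown v has the form L v t = const, L being
   the operator self_adjoint_op T t0 p q: the left-hand side Phi v differs from
   L v by a quantity which may depend on the unknown v but not on t. *)
Definition self_adjoint T t0 (Phi : (R -> R) -> R -> R) : Prop :=
  exists p q,
    [/\ rd_continuous T p, rd_continuous T q, forall t, T t -> p t != 0 &
        forall v, curve T v -> exists c : R, forall t, tkappa T t ->
          Phi v t = self_adjoint_op T t0 p q v t - c].

End TimeScales.

(* Main.v *)
(* Put A = d_2 H[u], B = d_3 H[u], C = d_2 G[u] and D = d_3 G[u] = - A.  By the
   product rule, D v^Delta = (D v)^Delta - D^Delta v^sigma, so the integral in
   the equation of variation is that of (C - D^Delta) v^sigma plus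
   D v - D(t0) v(t0).  Since v^sigma = v + mu v^Delta, the remaining terms
   combine as A (v^sigma - v) + B v^Delta = (B + mu A) v^Delta; hence
   p = B + mu A and q = C - D^Delta.  As delta_int is only meaningful when an
   antiderivative exists, one needs that rd-continuous functions have
   antiderivatives, and that these are unique up to a constant. *)

Require Import Defs.
From mathcomp Require Import all_boot all_order all_algebra.
From mathcomp Require Import all_classical all_reals all_analysis.
From mathcomp Require Import ring lra.

Set Implicit Arguments.
Unset Strict Implicit.
Unset Printing Implicit Defensive.

Import Order.TTheory GRing.Theory Num.Theory.
Import numFieldNormedType.Exports.
Local Open Scope classical_set_scope.
Local Open Scope ring_scope.

Section TimeScaleCalculus.
Context {R : realType} (T : set R).
Implicit Types (f g p q v w P Q : R -> R) (a b c d e s t : R).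

(** * Jump operators and the set [tkappa T] *)

Lemma sigma_ge t : t <= sigma T t.
Proof.
rewrite /sigma; case: pselect => // ne.
by apply: lb_le_inf => // s [_ /ltW].
Qed.

Lemma sigma_le t s : T s -> t < s -> sigma T t <= s.
Proof.
move=> Ts ts; rewrite /sigma; case: pselect => [ne|[]]; last by exists s.
by apply: ge_inf => //; exists t; move=> r [_ tr]; exact: ltW.
Qed.

Lemma rho_ge t s : T s -> s < t -> s <= rho T t.
Proof.
move=> Ts st; rewrite /rho; case: pselect => [ne|[]]; last by exists s.
by apply: ub_le_sup => //; exists t; move=> r [_ tr]; exact: ltW.
Qed.

Lemma rho_le t : rho T t <= t.
Proof.
rewrite /rho; case: pselect => // ne.
by apply: ge_sup => // s [_ /ltW].
Qed.

Lemma right_dense_adherent t s e : sigma T t = t -> T s -> t < s -> 0 < e ->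
  exists r, [/\ T r, t < r & r < t + e].
Proof.
move=> st Ts ts e0.
have := st; rewrite /sigma; case: pselect => [ne it|[]]; last by exists s.
have hi : has_inf [set r | T r /\ t < r].
  by split=> //; exists t; move=> r [_ tr]; exact: ltW.
by have [r [Tr tr]] := inf_adherent e0 hi; move: it => /= ->; exists r.
Qed.

Lemma tkappa_sub t : tkappa T t -> T t.
Proof. by rewrite /tkappa; case: pselect => // h []. Qed.

Lemma tkappa_lt t s : T t -> T s -> t < s -> tkappa T t.
Proof.
move=> Tt Ts ts; rewrite /tkappa; case: pselect => // -[ub rl] /=; split => // E.
by move: ts; rewrite E ltNge ub_le_sup.
Qed.

Lemma notin_tkappa t : T t -> ~ tkappa T t ->
  (forall s, T s -> s <= t) /\ rho T t < t.
Proof.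
move=> Tt; rewrite /tkappa; case: pselect => // -[ub rl] nt.
have -> : t = sup T by apply: contrapT => ne; apply: nt; split.
by split=> // s Ts; apply: ub_le_sup.
Qed.

(** At most one point of [T] is missing from [tkappa T], namely a maximum [m]. A point [t] of
    [tkappa T] lies strictly below it, and so do all points close to [t]. *)
Lemma near_within_tkappa t : tkappa T t ->
  \forall s \near within T (nbhs t), tkappa T s.
Proof.
move=> tt; have Tt := tkappa_sub tt.
have [[m [Tm nm]]|all] := pselect (exists m, T m /\ ~ tkappa T m).
  have [max _] := notin_tkappa Tm nm.
  have tm : t < m by rewrite lt_neqAle max // andbT; apply/eqP => E; rewrite -E in nm.
  rewrite near_withinE; near=> s => Ts; apply: (tkappa_lt Ts Tm).
  by near: s; exact: lt_nbhsl.
rewrite near_withinE; near=> s => Ts.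
by apply: contrapT => ns; apply: all; exists s.
Unshelve. all: by end_near. Qed.

(** The excluded point is a left-scattered maximum: [T] has nothing above it and nothing strictly
    between [rho T t] and [t]. Limits within [T] at this point are therefore trivial. *)
Lemma near_isolated t : T t -> ~ tkappa T t ->
  \forall s \near within T (nbhs t), s = t.
Proof.
move=> Tt nk; have [max rt] := notin_tkappa Tt nk.
rewrite near_withinE; near=> s => Ts.
have : rho T t < s by near: s; exact: lt_nbhsr.
move: (max s Ts); rewrite le_eqVlt => /predU1P[//|st].
by rewrite ltNge rho_ge.
Unshelve. all: by end_near. Qed.

Lemma left_dense_tkappa t : T t -> rho T t = t -> tkappa T t.
Proof.
move=> Tt rt; apply: contrapT => /(notin_tkappa Tt)[_].
by rewrite rt ltxx.
Qed.

Lemma sigma_in t : closed T -> T t -> T (sigma T t).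
Proof.
move=> clT Tt; rewrite /sigma; case: pselect => // ne.
have lb : has_lbound [set s | T s /\ t < s].
  by exists t; move=> r [_ tr]; exact: ltW.
apply: clT => B /nbhs_ballP[e /= e0 eB].
have [r [Tr tr] re] := inf_adherent e0 (conj ne lb).
exists r; split => //; apply: eB; rewrite /ball/= distrC ger0_norm; first lra.
by rewrite subr_ge0; apply: ge_inf.
Qed.

(** * Limits of the forward jump operator *)

Lemma sigma_dist_left t s : T t -> s < t -> `|t - sigma T s| <= `|t - s|.
Proof.
move=> Tt st; rewrite !ger0_norm ?subr_ge0 ?(ltW st) ?sigma_le//.
by rewrite lerD2l lerN2 sigma_ge.
Qed.

Lemma cvg_sigma_left t : closed T -> T t ->
  sigma T s @[s --> within (T `&` [set s | s < t]) (nbhs t)]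
    --> within T (nbhs t).
Proof.
move=> clT Tt U /nbhs_ballP[e /= e0 eU]; apply/nbhs_ballP; exists e => //= s.
rewrite /ball/= => tse [Ts /= st]; apply: eU; last exact: sigma_in.
by rewrite /ball/=; apply: le_lt_trans tse; exact: sigma_dist_left.
Qed.

(** Left of [t], [sigma T s] lies between [s] and [t]. Right of [t], density gives [r] in [T] with
    [t < r < t + e], and every [s < r] has [sigma T s <= r]; if [t] is the maximum, there is nothing
    to check on the right. *)
Lemma cvg_sigma_right_dense t : closed T -> T t -> sigma T t = t ->
  sigma T s @[s --> within T (nbhs t)] --> within T (nbhs t).
Proof.
move=> clT Tt stt U /nbhs_ballP[e /= e0 eU].
have [r r0 rle] : exists2 r, 0 < r &
    forall s, T s -> t < s -> s < t + r -> sigma T s < t + e.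
  have [[m [Tm tm]]|nm] := pselect (exists m, T m /\ t < m); last first.
    by exists 1 => // s Ts ts; case: nm; exists s.
  have [r [Tr tr re]] := right_dense_adherent stt Tm tm e0.
  exists (r - t); first by rewrite subr_gt0.
  move=> s Ts ts; rewrite subrKC => sr.
  by apply: le_lt_trans re; exact: sigma_le.
apply/nbhs_ballP; exists (Num.min e r); first by rewrite /= lt_min e0.
move=> s; rewrite /ball/= lt_min => /andP[tse tsr] Ts.
apply: eU; last exact: sigma_in.
rewrite /ball/=; case: (ltgtP s t) => [st|ts|->].
- by apply: le_lt_trans tse; exact: sigma_dist_left.
- have ss := sigma_ge s.
  have : sigma T s < t + e.
    by apply: rle => //; move: tsr; rewrite ltr0_norm; lra.
  by rewrite ltr0_norm; lra.
- by rewrite stt subrr normr0.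
Qed.

(** * Stability properties of rd-continuity *)

Lemma rd_continuousD f g : rd_continuous T f -> rd_continuous T g ->
  rd_continuous T (fun s => f s + g s).
Proof.
move=> [f1 f2] [g1 g2]; split=> t Tt dt.
  by apply: cvgD; [exact: f1|exact: g1].
have [l fl] := f2 t Tt dt; have [m gm] := g2 t Tt dt.
by exists (l + m); exact: cvgD.
Qed.

Lemma rd_continuousN f : rd_continuous T f ->
  rd_continuous T (fun s => - f s).
Proof.
move=> [f1 f2]; split=> t Tt dt; first by apply: cvgN; exact: f1.
by have [l fl] := f2 t Tt dt; exists (- l); exact: cvgN.
Qed.

Lemma rd_continuousM f g : rd_continuous T f -> rd_continuous T g ->
  rd_continuous T (fun s => f s * g s).
Proof.
move=> [f1 f2] [g1 g2]; split=> t Tt dt.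
  by apply: cvgM; [exact: f1|exact: g1].
have [l fl] := f2 t Tt dt; have [m gm] := g2 t Tt dt.
by exists (l * m); exact: cvgM.
Qed.

Lemma cvg_within_left t f (l : R) :
  f s @[s --> within T (nbhs t)] --> l ->
  f s @[s --> within (T `&` [set s | s < t]) (nbhs t)] --> l.
Proof.
by move=> fl U /fl; apply: (@filterS _ (nbhs t)) => s h [Ts _]; exact: h.
Qed.

(** At a left-dense, right-scattered [t], [sigma T s] tends to [t] and not to [sigma T t] as [s]
    increases to [t]. The composite is then discontinuous in general, but has the left limit
    [f t]. *)
Lemma rd_continuous_comp_sigma f : closed T ->
  (forall t, T t -> f s @[s --> within T (nbhs t)] --> f t) ->
  rd_continuous T (fun s => f (sigma T s)).
Proof.
move=> clT fc; split=> t Tt dt.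
  rewrite dt; apply: cvg_comp (fc t Tt); exact: cvg_sigma_right_dense.
exists (f t); apply: cvg_comp (fc t Tt); exact: cvg_sigma_left.
Qed.

Lemma rd_continuous_cont f :
  (forall t, T t -> f s @[s --> within T (nbhs t)] --> f t) ->
  rd_continuous T f.
Proof.
move=> fc; split=> t Tt dt; first exact: fc.
by exists (f t); apply: cvg_within_left; exact: fc.
Qed.

Lemma rd_continuous_mu : closed T -> rd_continuous T (mu T).
Proof.
move=> clT; have idc t : T t -> s @[s --> within T (nbhs t)] --> t.
  by move=> _; exact: cvg_within.
apply: rd_continuousD; first exact: (@rd_continuous_comp_sigma id).
by apply: rd_continuousN; exact: (@rd_continuous_cont id).
Qed.

(** A point of [T] outside [tkappa T] is isolated in [T], so changing the value there cannot affect
    any limit. At a maximum [sigma T t = t] by convention, so the continuity clause has to be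
    checked there too. *)
Lemma eq_rd_continuous f g : (forall t, tkappa T t -> f t = g t) ->
  rd_continuous T f -> rd_continuous T g.
Proof.
move=> fg [f1 f2]; split=> t Tt dt.
  have [tt|nt] := pselect (tkappa T t).
    rewrite -fg//; apply: cvg_trans (f1 t Tt dt).
    apply: near_eq_cvg; apply: filterS (near_within_tkappa tt) => s; exact: fg.
  apply: cvg_near_cst; apply: filterS (near_isolated Tt nt) => s -> //.
have [l fl] := f2 t Tt dt; exists l; apply: cvg_trans fl.
apply: near_eq_cvg; have := near_within_tkappa (left_dense_tkappa Tt dt).
by rewrite !near_withinE; apply: filterS => s h [Ts _]; apply: fg; exact: h.
Qed.

(** * Rules for delta derivatives and uniqueness of antiderivatives *)

Lemma cvg_delta_deriv f t d : T t -> is_delta_deriv T f t d ->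
  f s @[s --> within T (nbhs t)] --> f t.
Proof.
move=> Tt fd; apply/cvgrPdist_le => e e0.
set m := sigma T t - t; have m0 : 0 <= m by rewrite subr_ge0 sigma_ge.
(* The derivative estimate is used both at [s] and at [t] itself, with errors [k * (m + 1)] and
   [k * m]; the remaining term [d * (s - t)] costs [k * |d|]. Together they stay below [e]. *)
pose k := e / (2 * m + 1 + `|d| + 1).
have k0 : 0 < k by rewrite divr_gt0//; have := normr_ge0 d; lra.
have kE : k * (2 * m + 1 + `|d| + 1) = e.
  by rewrite divfK// gt_eqF//; have := normr_ge0 d; lra.
have := fd _ k0; rewrite !near_withinE => H.
have Ht := nbhs_singleton H Tt.
near=> s => Ts.
have Hs : T s -> `|f (sigma T t) - f s - d * (sigma T t - s)| <=
    k * `|sigma T t - s| by near: s.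
have ts1 : `|t - s| <= 1.
  by near: s; apply/nbhs_ballP; exists 1 => //= s; rewrite /ball/= => /ltW.
have tsk : `|t - s| <= k.
  by near: s; apply/nbhs_ballP; exists k => //= s; rewrite /ball/= => /ltW.
have -> : f t - f s = (f (sigma T t) - f s - d * (sigma T t - s))
  - (f (sigma T t) - f t - d * (sigma T t - t)) - d * (s - t) by ring.
apply: (le_trans (ler_normB _ _)); apply: (le_trans (lerD (ler_normB _ _) (lexx _))).
have h1 : `|sigma T t - s| <= m + 1.
  have -> : sigma T t - s = m + (t - s) by rewrite /m; ring.
  by apply: (le_trans (ler_normD _ _)); rewrite (ger0_norm m0) lerD2l.
have h2 : `|d * (s - t)| <= k * `|d|.
  by rewrite normrM distrC mulrC ler_wpM2r.
have h3 : k * `|sigma T t - s| <= k * (m + 1) by rewrite ler_wpM2l// ltW.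
have h4 : `|sigma T t - t| = m by rewrite ger0_norm.
by rewrite h4 in Ht; have := Hs Ts; lra.
Unshelve. all: by end_near. Qed.

Lemma is_delta_derivD f g t (c d : R) :
  is_delta_deriv T f t c -> is_delta_deriv T g t d ->
  is_delta_deriv T (fun s => f s + g s) t (c + d).
Proof.
move=> fc gd e e0; have e2 : 0 < e / 2 by rewrite divr_gt0.
have := fc _ e2; have := gd _ e2; apply: filterS2 => s hg hf.
have -> : f (sigma T t) + g (sigma T t) - (f s + g s)
    - (c + d) * (sigma T t - s) =
  (f (sigma T t) - f s - c * (sigma T t - s)) +
  (g (sigma T t) - g s - d * (sigma T t - s)) by ring.
by apply: (le_trans (ler_normD _ _)); lra.
Qed.

Lemma is_delta_derivN f t d : is_delta_deriv T f t d ->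
  is_delta_deriv T (fun s => - f s) t (- d).
Proof.
move=> fd e /fd; apply: filterS => s.
by rewrite -normrN; congr (`|_| <= _); ring.
Qed.

Lemma is_delta_derivM f g t (c d : R) : T t ->
  is_delta_deriv T f t c -> is_delta_deriv T g t d ->
  is_delta_deriv T (fun s => f s * g s) t (c * g (sigma T t) + f t * d).
Proof.
move=> Tt fc gd e e0.
have /cvgrPdist_le ft := cvg_delta_deriv Tt fc.
(* The summands of [K] are bounds for the factors of the three error terms in the expansion below,
   with [|f t| + 1] bounding [|f s|] near [t]. *)
pose K := `|g (sigma T t)| + `|f t| + 1 + `|d|.
have K0 : 0 < K by rewrite ltr_wpDr// ltr_wpDl// addr_ge0.
pose k := e / K; have k0 : 0 < k by rewrite divr_gt0.
have ke : k * K = e by rewrite divfK// gt_eqF.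
have hc := fc _ k0; have hd := gd _ k0.
have k1 : 0 < Num.min 1 k by rewrite lt_min ltr01.
have := ft _ k1; move: hc hd; apply: filterS3 => s.
set r := sigma T t - s; rewrite le_min => H1 H2 /andP[H3 H4].
have -> : f (sigma T t) * g (sigma T t) - f s * g s
    - (c * g (sigma T t) + f t * d) * r =
  g (sigma T t) * (f (sigma T t) - f s - c * r) +
  f s * (g (sigma T t) - g s - d * r) - (f t - f s) * d * r by ring.
apply: (le_trans (ler_normB _ _)).
apply: (le_trans (lerD (ler_normD _ _) (lexx _))); rewrite !normrM.
have fs : `|f s| <= `|f t| + 1.
  have -> : f s = f t - (f t - f s) by ring.
  by apply: (le_trans (ler_normB _ _)); rewrite lerD2l.
have A1 : `|g (sigma T t)| * `|f (sigma T t) - f s - c * r| <=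
  `|g (sigma T t)| * (k * `|r|) by rewrite ler_wpM2l.
have A2 : `|f s| * `|g (sigma T t) - g s - d * r| <=
  (`|f t| + 1) * (k * `|r|) by rewrite ler_pM.
have A3 : `|f t - f s| * `|d| * `|r| <= k * `|d| * `|r|.
  by rewrite !ler_wpM2r.
suff -> : e * `|r| = `|g (sigma T t)| * (k * `|r|) +
  (`|f t| + 1) * (k * `|r|) + k * `|d| * `|r| by rewrite !lerD.
by rewrite -ke /K; ring.
Qed.

(** For each slope [e > 0], let [c] be the supremum of the points of [[a, b]] up to which [f] has
    moved by at most [e] times the distance from [a]. The bound persists at [c] by continuity, and
    if [c < b] it would extend to a point beyond [c]; so it holds at [b], and [e] is arbitrary. *)
Lemma is_delta_deriv0_const f : closed T ->
  (forall t, tkappa T t -> is_delta_deriv T f t 0) ->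
  forall a b, T a -> T b -> f a = f b.
Proof.
move=> clT f0; suff H a b : T a -> T b -> a < b -> f a = f b.
  by move=> a b Ta Tb; case: (ltgtP a b) => [|/H ->|->] //; exact: H.
move=> Ta Tb ab.
suff le0 e : 0 < e -> `|f b - f a| <= e * (b - a).
  apply/eqP; rewrite eq_sym -subr_eq0 -normr_le0; apply/ler_addgt0Pl => e e0.
  rewrite addr0; have ba : 0 < b - a by rewrite subr_gt0.
  by have := le0 _ (divr_gt0 e0 ba); rewrite divfK// gt_eqF.
move=> e0.
have near0 t : tkappa T t -> exists2 r, 0 < r & forall s, T s ->
    `|t - s| < r -> `|f (sigma T t) - f s| <= e * `|sigma T t - s|.
  move=> tt; have := f0 t tt _ e0; rewrite near_withinE => /nbhs_ballP[r /= r0 H].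
  by exists r => // s Ts ts; have := H s ts Ts; rewrite mul0r subr0.
pose S := [set t | [/\ T t, a <= t, t <= b & `|f t - f a| <= e * (t - a)]].
have Sa : S a by split; rewrite ?subrr ?normr0 ?mulr0 ?(ltW ab).
have hS : has_sup S by split; [exists a | exists b => t []].
pose c := sup S.
have ac : a <= c by apply: ub_le_sup => //; case: hS.
have cb : c <= b by apply: ge_sup; [case: hS | move=> t []].
have Sle s : S s -> s <= c by move=> Ss; apply: ub_le_sup => //; case: hS.
have adh r : 0 < r -> exists2 s, S s & c - r < s.
  by move=> r0; exact: sup_adherent.
have Tc : T c.
  apply: clT => B /nbhs_ballP[r /= r0 rB]; have [s Ss cs] := adh _ r0.
  exists s; split; [by case: Ss | apply: rB].
  by rewrite /ball/= ger0_norm ?subr_ge0 ?Sle//; lra.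
have Sc : S c.
  apply: contrapT => nSc.
  have Slt s : S s -> s < c.
    move=> Ss; rewrite lt_neqAle Sle// andbT; apply/eqP => E.
    by apply: nSc; rewrite -E.
  (* Otherwise [c] is left-scattered, although points of [S] accumulate at it from below. *)
  have kc : tkappa T c.
    apply: contrapT => /(notin_tkappa Tc)[_ rc].
    have [s Ss] : exists2 s, S s & c - (c - rho T c) < s.
      by apply: adh; rewrite subr_gt0.
    by rewrite subKr ltNge rho_ge//; [case: Ss | exact: Slt].
  have /cvgrPdist_le fc := cvg_delta_deriv Tc (f0 c kc).
  apply: nSc; split => //; apply/ler_addgt0Pl => k k0.
  have := fc _ k0; rewrite near_withinE => /nbhs_ballP[r /= r0 rP].
  have [s Ss cs] := adh _ r0.
  have sc := Slt s Ss; case: Ss => Ts _ _ fs.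
  have fcs : `|f c - f s| <= k.
    by apply: rP => //; rewrite /ball/= ger0_norm ?subr_ge0 ?(ltW sc)//; lra.
  have -> : f c - f a = (f c - f s) + (f s - f a) by ring.
  have es : e * (s - a) <= e * (c - a) by rewrite ler_pM2l// lerD2r ltW.
  by apply: (le_trans (ler_normD _ _)); apply: lerD => //; exact: le_trans es.
have [_ _ _ fca] := Sc.
have ext s : T s -> c < s -> s <= b -> `|f s - f c| <= e * (s - c) -> False.
  move=> Ts cs sb fsc; suff /Sle : S s by rewrite leNgt cs.
  split => //; first exact: le_trans (ltW cs).
  have -> : f s - f a = (f s - f c) + (f c - f a) by ring.
  by apply: (le_trans (ler_normD _ _)); lra.
have [cltb|] := ltP c b; last first.
  by move=> bc; have <- : c = b by apply/le_anti; rewrite cb.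
exfalso; have [r r0 rP] := near0 c (tkappa_lt Tc Tb cltb).
(* The point beyond [c] is [sigma T c] if [c] is right-scattered, and a nearby point of [T] if [c]
   is right-dense. *)
have [sc|] := eqVneq (sigma T c) c; last first.
  rewrite neq_lt ltNge sigma_ge /= => cs.
  apply: (ext (sigma T c)) => //; [exact: sigma_in|exact: sigma_le|].
  have := rP c Tc; rewrite subrr normr0 => /(_ r0).
  by rewrite (@ger0_norm _ (sigma T c - c)) ?subr_ge0 ?sigma_ge.
have rb0 : 0 < Num.min r (b - c) by rewrite lt_min r0 subr_gt0.
have [s [Ts cs]] := right_dense_adherent sc Tb cltb rb0.
rewrite -ltrBlDl lt_min => /andP[scr scb].
apply: (ext s) => //; first by lra.
have cs0 : 0 <= s - c by rewrite subr_ge0 ltW.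
have := rP s Ts; rewrite sc (distrC c s) (ger0_norm cs0) distrC; exact.
Qed.

(** Two antiderivatives differ by a function of zero derivative, hence by a constant, so the set
    inside [get] is a singleton. *)
Lemma delta_int_eq f P a b : closed T -> T a -> T b ->
  delta_antideriv T f P -> delta_int T f a b = P b - P a.
Proof.
move=> clT Ta Tb fP; apply: get_unique; first by exists P.
move=> _ [Q fQ ->]; have PQ t : tkappa T t ->
    is_delta_deriv T (fun s => Q s - P s) t 0.
  move=> tt; rewrite -(subrr (f t)).
  by apply: is_delta_derivD; [exact: fQ | apply: is_delta_derivN; exact: fP].
have := is_delta_deriv0_const clT PQ Ta Tb => /= E; lra.
Qed.

(** * Existence of antiderivatives of rd-continuous functions *)

Lemma rd_continuous_bounded f a b : closed T -> rd_continuous T f ->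
  exists M, forall s, T s -> a <= s <= b -> `|f s| <= M.
Proof.
move=> clT [f1 f2].
have bnd (D : set R) t l : f s @[s --> within D (nbhs t)] --> l ->
    \forall s \near nbhs t, D s -> `|f s| <= `|l| + 1.
  move=> /cvgrPdist_le/(_ _ ltr01); rewrite near_withinE; apply: filterS => s h Ds.
  have -> : f s = l - (l - f s) by ring.
  by apply: (le_trans (ler_normB _ _)); rewrite lerD2l h.
(* Right-dense points use continuity. Near a right-scattered point only the left side and the point
   itself count: the left side is controlled by the left limit, or empty if the point is also
   left-scattered. *)
have loc t : exists M, \forall s \near nbhs t, T s -> `|f s| <= M.
  have [Tt|nTt] := pselect (T t); last first.
    exists 0; have /= := open_nbhs_nbhs (conj (closed_openC clT) nTt).
    by apply: filterS => s nTs /nTs.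
  have [st|st] := eqVneq (sigma T t) t; first by exists (`|f t| + 1);
    exact: bnd (f1 t Tt st).
  have st' : t < sigma T t by rewrite lt_neqAle eq_sym st sigma_ge.
  have [M HM] : exists M, \forall s \near nbhs t, T s -> s < t -> `|f s| <= M.
    have [rt|rt] := eqVneq (rho T t) t.
      have [l fl] := f2 t Tt rt; exists (`|l| + 1).
      by apply: filterS (bnd _ _ _ fl) => s h Ts st1; apply: h.
    have rt' : rho T t < t by rewrite lt_neqAle rt rho_le.
    exists 0; apply: filterS (lt_nbhsr rt') => s rs Ts st1.
    by move: rs; rewrite ltNge rho_ge.
  exists (Num.max M `|f t|).
  apply: filterS2 HM (lt_nbhsl st') => s h ss Ts; rewrite le_max.
  case: (ltgtP s t) => [stl|ts|->]; rewrite ?lexx ?orbT//; first by rewrite h.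
  by move: ss; rewrite ltNge sigma_le.
(* With the filter at infinity for the bounds, compactness of [[a, b]] turns the local bounds into
   one that is valid for every real greater than some [M]; hence [M + 1] at the end. *)
have cpt := (compact_near_coveringP _).1 (@segment_compact _ a b).
have [s _|M [_ H]] := cpt R (pinfty_nbhs R) (fun M s => T s -> `|f s| <= M) _.
  have [M HM] := loc s.
  exists ([set s | T s -> `|f s| <= M], [set K | M <= K]) => /=.
    by split => //; exists M; split; [exact: num_real|move=> K /ltW].
  by move=> [s' K] [/= h MK Ts]; apply: le_trans MK; exact: h.
exists (M + 1) => s Ts sab; apply: (H (M + 1)) => //; first by rewrite ltrDl.
Qed.

(* The increments [g b - g a] of the functions [g] of this set are bounded by
   the upper Darboux sums of [f] over [a, b]; their supremum is the upper
   Darboux integral, whose additivity comes from gluing two such [g]. *)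
Definition subdarboux f a b : set (R -> R) :=
  [set g | forall x y K, T x -> T y -> a <= x -> x < y -> y <= b ->
    (forall s, T s -> x <= s -> s < y -> f s <= K) -> g y - g x <= K * (y - x)].

Definition upper_integral f a b : R :=
  sup [set g b - g a | g in subdarboux f a b].

Lemma subdarboux_le f a b g K : subdarboux f a b g -> T a -> T b -> a <= b ->
  (forall s, T s -> a <= s -> s < b -> f s <= K) -> g b - g a <= K * (b - a).
Proof.
move=> gs Ta Tb; rewrite le_eqVlt => /predU1P[<-|ab] fK; last exact: gs.
by rewrite !subrr mulr0.
Qed.

Lemma subdarboux_linear f a b k :
  (forall s, T s -> a <= s -> s < b -> k <= f s) ->
  subdarboux f a b (fun z => k * z).
Proof.
move=> fk x y K Tx Ty ax xy yb fK; rewrite -mulrBr ler_pM2r ?subr_gt0//.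
by apply: (le_trans (fk x Tx ax _)); [exact: lt_le_trans yb|exact: fK].
Qed.

(** An interval straddling [b] is cut at [b]; the same [K] bounds [f] on both pieces, and the two
    estimates add up. *)
Lemma subdarboux_glue f a b c g h : T b -> a <= b -> b <= c ->
  subdarboux f a b g -> subdarboux f b c h ->
  subdarboux f a c (fun z => if z <= b then g z else h z - h b + g b).
Proof.
move=> Tb ab bc gs hs x y K Tx Ty ax xy yc fK.
have [yb|by_] := leP y b.
  by rewrite (ltW (lt_le_trans xy yb)); exact: gs.
have [xb|bx] := leP x b; last first.
  have -> : h y - h b + g b - (h x - h b + g b) = h y - h x by ring.
  by apply: hs => //; exact: ltW.
have hK : h y - h b <= K * (y - b).
  by apply: hs => // s Ts bs sy; apply: fK => //; exact: le_trans bs.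
have gK : g b - g x <= K * (b - x).
  move: xb; rewrite le_eqVlt => /predU1P[->|xb]; first by rewrite !subrr mulr0.
  by apply: gs => // s Ts xs sb; apply: fK => //; exact: lt_trans by_.
lra.
Qed.

Section UpperIntegral.
Context (f : R -> R).
Context (f_bounded : forall a b, exists M,
  forall s, T s -> a <= s <= b -> `|f s| <= M).

Lemma has_sup_subdarboux a b : T a -> T b -> a <= b ->
  has_sup [set g b - g a | g in subdarboux f a b].
Proof.
move=> Ta Tb ab; have [M fM] := f_bounded a b; split.
  exists (- M * b - - M * a); exists (fun z => - M * z) => //.
  apply: subdarboux_linear => s Ts as_ sb.
  have := fM s Ts; rewrite as_ (ltW sb) => /(_ isT).
  by rewrite ler_norml => /andP[].
exists (M * (b - a)) => _ [g gs <-]; apply: subdarboux_le gs _ _ _ _ => //.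
move=> s Ts as_ sb; have := fM s Ts; rewrite as_ (ltW sb) => /(_ isT).
by rewrite ler_norml => /andP[].
Qed.

(** The linear function of slope [k] is one of the competitors, which gives the lower bound; the
    upper bound holds for each competitor. *)
Lemma upper_integral_bounds a b k K : T a -> T b -> a <= b ->
  (forall s, T s -> a <= s -> s < b -> k <= f s <= K) ->
  k * (b - a) <= upper_integral f a b <= K * (b - a).
Proof.
move=> Ta Tb ab fkK; have [ne ub] := has_sup_subdarboux Ta Tb ab.
apply/andP; split.
  apply: ub_le_sup => //; exists (fun z => k * z); last by rewrite mulrBr.
  by apply: subdarboux_linear => s Ts as_ sb; have /andP[] := fkK s Ts as_ sb.
apply: ge_sup => // _ [g gs <-]; apply: subdarboux_le gs _ _ _ _ => //.
by move=> s Ts as_ sb; have /andP[] := fkK s Ts as_ sb.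
Qed.

(** A competitor on [[a, c]] restricts to both halves, which gives one inequality. Gluing
    competitors optimal up to [e / 2] on each half gives the other. *)
Lemma upper_integral_add a b c : T a -> T b -> T c -> a <= b -> b <= c ->
  upper_integral f a c = upper_integral f a b + upper_integral f b c.
Proof.
move=> Ta Tb Tc ab bc; have ac := le_trans ab bc.
have [ne ub] := has_sup_subdarboux Ta Tc ac.
have hs1 := has_sup_subdarboux Ta Tb ab.
have hs2 := has_sup_subdarboux Tb Tc bc.
apply/le_anti/andP; split.
  apply: ge_sup => // _ [g gs <-].
  have -> : g c - g a = (g b - g a) + (g c - g b) by ring.
  apply: lerD; apply: ub_le_sup; [by case: hs1| |by case: hs2|];
    exists g => //= x y K Tx Ty ax xy yb; apply: gs => //.
  - exact: le_trans bc.
  - exact: le_trans ax.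
apply/ler_addgt0Pr => e e0; have e2 : 0 < e / 2 by rewrite divr_gt0.
have [_ [g gs <-] ge] := sup_adherent e2 hs1.
have [_ [h hs <-] he] := sup_adherent e2 hs2.
have := subdarboux_glue Tb ab bc gs hs; set w := (fun z => _) => ws.
have wE : w c - w a = (g b - g a) + (h c - h b).
  rewrite /w ab; case: (leP c b) => cb; last by ring.
  have -> : c = b by apply/le_anti; rewrite cb.
  by ring.
have : w c - w a <= upper_integral f a c by apply: ub_le_sup => //; exists w.
by move: ge he; rewrite -/(upper_integral _ _ _) -/(upper_integral _ _ _) wE; lra.
Qed.

End UpperIntegral.

Lemma rd_continuous_delta_antideriv a0 f : closed T -> T a0 ->
  rd_continuous T f -> exists P, delta_antideriv T f P.
Proof.
move=> clT Ta0 rdf.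
have bnd a b := @rd_continuous_bounded f a b clT rdf.
(* [P] is the upper integral from [a0], with reversed sign to the left of [a0], so that its
   increments are upper integrals wherever they start. *)
pose U := upper_integral f; pose P t := if a0 <= t then U a0 t else - U t a0.
have PE a b : T a -> T b -> a <= b -> P b - P a = U a b.
  move=> Ta Tb ab; rewrite /P; case: (leP a0 a) => [a0a|/ltW aa0].
    by rewrite (le_trans a0a ab) /U (upper_integral_add bnd Ta0 Ta Tb a0a ab); ring.
  case: (leP a0 b) => [a0b|/ltW ba0].
    by rewrite /U (upper_integral_add bnd Ta Ta0 Tb aa0 a0b); ring.
  by rewrite /U (upper_integral_add bnd Ta Tb Ta0 ab ba0); ring.
have Pbnd a b c e : T a -> T b -> a <= b ->
    (forall s, T s -> a <= s -> s < b -> `|f s - c| <= e) ->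
    `|P b - P a - c * (b - a)| <= e * (b - a).
  move=> Ta Tb ab fe; rewrite PE//.
  have : (c - e) * (b - a) <= U a b <= (c + e) * (b - a).
    apply: upper_integral_bounds => // s Ts as_ sb.
    by have := fe s Ts as_ sb; rewrite ler_norml => /andP[h1 h2]; apply/andP; split; lra.
  by move=> /andP[h1 h2]; rewrite ler_norml; apply/andP; split; lra.
exists P => t /tkappa_sub Tt e e0.
have [st|st] := eqVneq (sigma T t) t.
  have /cvgrPdist_le/(_ _ e0) := rdf.1 t Tt st; rewrite st !near_withinE.
  move=> /nbhs_ballP[r /= r0 rP]; apply/nbhs_ballP; exists r => //= s.
  rewrite /ball/= => str Ts; case: (leP s t) => [sle|/ltW tle].
    rewrite (@ger0_norm _ (t - s)) ?subr_ge0//; apply: Pbnd => // x Tx sx xt.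
    rewrite distrC; apply: rP => //; rewrite /ball/=.
    move: str; rewrite !ger0_norm ?subr_ge0 ?(ltW xt)//; lra.
  rewrite -normrN (distrC t s) (@ger0_norm _ (s - t)) ?subr_ge0//.
  have -> : - (P t - P s - f t * (t - s)) = P s - P t - f t * (s - t) by ring.
  apply: Pbnd => // x Tx tx xs; rewrite distrC; apply: rP => //; rewrite /ball/=.
  move: str; rewrite distrC (distrC t x) !ger0_norm ?subr_ge0//; lra.
have m0 : 0 < sigma T t - t by rewrite subr_gt0 lt_neqAle eq_sym st sigma_ge.
(* The only point of [T] in [[t, sigma T t)] is [t], so [Pbnd] applies with error [0]. *)
have jump : P (sigma T t) - P t - f t * (sigma T t - t) = 0.
  apply/eqP; rewrite -normr_le0 -[leRHS](mul0r (sigma T t - t)).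
  apply: Pbnd => //; [exact: sigma_in|exact: sigma_ge|] => s Ts ts ss.
  move: ts; rewrite le_eqVlt => /predU1P[<-|ts]; first by rewrite subrr normr0.
  by move: ss; rewrite ltNge sigma_le.
have [M fM] := bnd (t - 1) t.
(* [f] may be discontinuous from the left here, but [sigma T t - s] stays at least
   [sigma T t - t > 0]. So it suffices that [K], a bound for [|f x - f t|] on [[t - 1, t]],
   satisfies [K * (t - s) <= e * (sigma T t - t)]. The radius [sigma T t - t] excludes points right
   of [t]. *)
pose K := `|M| + `|f t| + 1; have K0 : 0 < K by rewrite ltr_wpDl// addr_ge0.
pose r := Num.min 1 (e * (sigma T t - t) / K).
have r0 : 0 < r by rewrite lt_min ltr01 divr_gt0// mulr_gt0.
rewrite near_withinE; apply/nbhs_ballP; exists (Num.min r (sigma T t - t)) => /=.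
  by rewrite lt_min r0.
move=> s; rewrite /ball/= !lt_min => /andP[/andP[s1 sK] sm] Ts.
have sle : s <= t.
  rewrite leNgt; apply/negP => ts; have := sigma_le Ts ts.
  by move: sm; rewrite distrC gtr0_norm ?subr_gt0//; lra.
rewrite (@ger0_norm _ (t - s)) ?subr_ge0// in s1 sK sm.
have -> : P (sigma T t) - P s - f t * (sigma T t - s) =
    P t - P s - f t * (t - s) by have := jump; lra.
rewrite (@ger0_norm _ (sigma T t - s)); last by lra.
apply: (@le_trans _ _ (K * (t - s))).
  apply: Pbnd => // x Tx sx xt; apply: (le_trans (ler_normB _ _)).
  have : `|f x| <= M by apply: fM => //; apply/andP; split; lra.
  by have := ler_norm M; rewrite /K; lra.
apply: (@le_trans _ _ (e * (sigma T t - t))); last by rewrite ler_pM2l//; lra.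
by move: sK; rewrite ltr_pdivlMr// mulrC => /ltW.
Qed.

Lemma cont_of_delta_derivable v :
  (forall t, tkappa T t -> delta_derivable T v t) ->
  forall t, T t -> v s @[s --> within T (nbhs t)] --> v t.
Proof.
move=> dv t Tt; have [/dv[d vd]|nt] := pselect (tkappa T t).
  exact: cvg_delta_deriv vd.
by apply: cvg_near_cst; apply: filterS (near_isolated Tt nt) => s ->.
Qed.

Lemma delta_derivP v t : delta_derivable T v t ->
  is_delta_deriv T v t (delta_deriv T v t).
Proof. by move=> [d vd]; apply: getPex; exists d. Qed.

End TimeScaleCalculus.

(** * Self-adjointness of the equation of variation *)

Theorem lemma3p4 (R : realType) (T : set R) (t0 : R) (H G : R -> R -> R -> R)
  (hT : time_scale T) (ht0 : T t0)
  (hHG : integro_diff_assumptions T H G)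
  (hsum : forall y : R -> R, curve T y -> forall t : R, tkappa T t ->
     along T (partial2 H) y t + along T (partial3 G) y t = 0)
  (u : R -> R) (hu : curve T u)
  (hreg : rd_C1 T (along T (partial3 G) u))
  (hlead : forall t : R, tkappa T t ->
     along T (partial3 H) u t + mu T t * along T (partial2 H) u t != 0) :
  self_adjoint T t0 (variation_lhs T t0 H G u).
Proof.
have clT := hT.2; have [[_ rdH] [_ rdG] _] := hHG.
have [rdA rdB] := rdH u hu; have [rdC _] := rdG u hu; have [dD rdD'] := hreg.
have {hsum}hsum := hsum u hu.
move: hlead rdA rdB rdC dD rdD' hsum.
rewrite /self_adjoint /variation_lhs.
set A := along T (partial2 H) u; set B := along T (partial3 H) u.
set C := along T (partial2 G) u; set D := along T (partial3 G) u.
move=> hlead rdA rdB rdC dD rdD' hsum.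
(* [hlead] gives [p t != 0] only on [tkappa T]. At a left-scattered maximum the value [1] is taken,
   which is harmless for rd-continuity since that point is isolated. *)
pose p t := if pselect (tkappa T t) then B t + mu T t * A t else 1.
pose q t := C t - delta_deriv T D t.
have rdq : rd_continuous T q by apply: rd_continuousD => //; exact: rd_continuousN.
exists p, q; split=> //.
- apply: (@eq_rd_continuous _ _ (fun t => B t + mu T t * A t)) => [t tt|].
    by rewrite /p; case: pselect.
  by apply: rd_continuousD => //; apply: rd_continuousM => //; exact: rd_continuous_mu.
- by move=> t Tt; rewrite /p; case: pselect => /= [/hlead|_]; rewrite ?oner_neq0.
move=> v [dv _].
have [P qP] : exists P, delta_antideriv T (fun s => q s * v (sigma T s)) P.
  apply: (rd_continuous_delta_antideriv clT ht0); apply: rd_continuousM => //.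
  by apply: rd_continuous_comp_sigma => //; exact: cont_of_delta_derivable.
(* The term [- delta_deriv T D] in [q] cancels against the derivative of [D] in the product rule for
   [D * v]. *)
have PDv : delta_antideriv T (fun s => C s * v (sigma T s) +
    D s * delta_deriv T v s) (fun s => P s + D s * v s).
  move=> t tt.
  have -> : C t * v (sigma T t) + D t * delta_deriv T v t =
      q t * v (sigma T t) +
      (delta_deriv T D t * v (sigma T t) + D t * delta_deriv T v t).
    by rewrite /q; ring.
  apply: is_delta_derivD; first exact: qP.
  apply: is_delta_derivM; [exact: tkappa_sub|exact/delta_derivP/dD|].
  exact/delta_derivP/dv.
(* This is the boundary term of [D * v] at the lower limit of integration. *)
exists (D t0 * v t0) => t tt; have Tt := tkappa_sub tt.
rewrite /self_adjoint_op (delta_int_eq clT ht0 Tt PDv) (delta_int_eq clT ht0 Tt qP).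
rewrite /p; case: pselect => //= _.
have DA : D t = - A t by have := hsum t tt; lra.
have vs : v (sigma T t) = v t + mu T t * delta_deriv T v t.
  suff : v (sigma T t) - v t - delta_deriv T v t * mu T t = 0 by lra.
  (* The derivative estimate is taken at [s = t], where it reads as an error of at most a tolerance
     times [mu T t]. The tolerance [e / (mu T t + 1)] brings this below [e], also when
     [mu T t = 0]. *)
  apply/eqP; rewrite -normr_le0; apply/ler_addgt0Pr => e e0; rewrite add0r.
  have m0 : 0 <= mu T t by rewrite subr_ge0 sigma_ge.
  have k0 : 0 < e / (mu T t + 1) by rewrite divr_gt0// ltr_wpDl.
  have /delta_derivP/(_ _ k0) := dv t tt.
  rewrite near_withinE => /nbhs_singleton/(_ Tt) h; apply: le_trans h _.
  rewrite -/(mu T t) ger0_norm// mulrAC ler_pdivrMr ?ltr_wpDl//.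
  by rewrite ler_pM2l// lerDl.
by rewrite DA vs; ring.
Qed.
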